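(* Let $n\geqslant 1$. If $\mathbb{C}$ is a Jónsson category of order $n$ (for any $n$), then $\mathbb{C}$ satisfies the trapezoid lemma.
   Context: A category is regular if it has finite limits and coequalisers of kernel pairs, and regular epimorphisms are stable under pullback. A relation on an object $A$ is a subobject of $A\times A$, ordered by inclusion of subobjects ($\leqslant$); $\wedge$ is the meet of subobjects. Equivalence relations are internal ones (reflexive, symmetric, transitive). Composition of relations in a regular category: for relations $R,S$ on $A$ represented by $(r_1,r_2)$ and $(s_1,s_2)$, with $(P,p_1,p_2)$ the pullback of $s_1$ along $r_2$ (so $r_2p_1=s_1p_2$), $R\circ S$ is represented by the mono part of the (regular epi, mono) factorisation of $(r_1p_1,s_2p_2)\colon P\to A\times A$. For relations $U,V$ on $A$ and $k\geqslant1$, $(U,V)_k=U\circ V\circ U\circ\cdots$ is the alternating composite with $k$ factors, beginning with $U$. For $n\geqslant 1$, a regular category $\mathbb{C}$ is a Jónsson category of order $n$ if for any three equivalence relations $R,S,T$ on any object $A$ of $\mathbb{C}$ one has $R\wedge (S\circ T)\leqslant (R\wedge S, R\wedge T)_{n+1}$. For a relation $R$ on $A$ and morphisms $x,y\colon X\to A$ with a common domain, $xRy$ means that $(x,y)\colon X\to A\times A$ factors through a representative of $R$. A category $\mathbb{C}$ satisfies the trapezoid lemma if, for any three equivalence relations $R,S,T$ on any object $A$ of $\mathbb{C}$ with $R\wedge S\leqslant T$, and any morphisms $x,y,u,v$ with codomain $A$ and common domain such that $xSu$, $uTv$, $ySv$ and $xRy$, we have $xTy$. *)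

(* Defs.v *)
From Stdlib Require Import List FinFun ClassicalEpsilon.

Set Implicit Arguments.
Unset Strict Implicit.

Declare Scope cat_scope.
Delimit Scope cat_scope with cat.
Local Open Scope cat_scope.

Record Category : Type := {
  Ob :> Type;
  Hom : Ob -> Ob -> Type;
  idm : forall X : Ob, Hom X X;
  comp : forall X Y Z : Ob, Hom Y Z -> Hom X Y -> Hom X Z;
  comp_assoc : forall (W X Y Z : Ob) (h : Hom Y Z) (g : Hom X Y) (f : Hom W X),
    comp h (comp g f) = comp (comp h g) f;
  comp_idl : forall (X Y : Ob) (f : Hom X Y), comp (idm Y) f = f;
  comp_idr : forall (X Y : Ob) (f : Hom X Y), comp f (idm X) = f
}.
Arguments Hom {c} X Y.
Arguments idm {c} X.
Arguments comp {c X Y Z} g f : rename.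

Notation "g ∘ f" := (comp g f) (at level 40, left associativity) : cat_scope.

Record Functor (J C : Category) : Type := {
  fobj :> J -> C;
  fmap : forall i j : J, Hom i j -> Hom (fobj i) (fobj j);
  fmap_id : forall i : J, fmap (idm i) = idm (fobj i);
  fmap_comp : forall (i j k : J) (g : Hom j k) (f : Hom i j),
    fmap (g ∘ f) = fmap g ∘ fmap f
}.
Arguments fmap {J C} f {i j} _ : rename.

Record Cone (J C : Category) (F : Functor J C) : Type := {
  apex : C;
  leg : forall j : J, Hom apex (F j);
  leg_natural : forall (i j : J) (f : Hom i j), fmap F f ∘ leg i = leg j
}.
Arguments apex {J C F} c : rename.
Arguments leg {J C F} c j : rename.

Definition IsLimit (J C : Category) (F : Functor J C) (L : Cone F) : Prop :=
  forall K : Cone F,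
    exists! u : Hom (apex K) (apex L), forall j : J, leg L j ∘ u = leg K j.

Definition FiniteCategory (J : Category) : Prop :=
  Finite J /\ forall i j : J, Finite (Hom i j).

Class HasFiniteLimits (C : Category) : Prop :=
  finite_limits : forall (J : Category) (F : Functor J C),
    FiniteCategory J -> exists L : Cone F, IsLimit L.

Definition Mono (C : Category) (X Y : C) (m : Hom X Y) : Prop :=
  forall (W : C) (f g : Hom W X), m ∘ f = m ∘ g -> f = g.

Definition IsProduct (C : Category) (X Y P : C) (p1 : Hom P X) (p2 : Hom P Y) :
  Prop :=
  forall (W : C) (f : Hom W X) (g : Hom W Y),
    exists! u : Hom W P, p1 ∘ u = f /\ p2 ∘ u = g.

Definition IsPullback (C : Category) (X Y Z P : C) (f : Hom X Z) (g : Hom Y Z)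
  (p1 : Hom P X) (p2 : Hom P Y) : Prop :=
  f ∘ p1 = g ∘ p2 /\
  forall (W : C) (a : Hom W X) (b : Hom W Y), f ∘ a = g ∘ b ->
    exists! u : Hom W P, p1 ∘ u = a /\ p2 ∘ u = b.

Definition IsKernelPair (C : Category) (X Y K : C) (f : Hom X Y)
  (k1 k2 : Hom K X) : Prop := IsPullback f f k1 k2.

Definition IsCoequaliser (C : Category) (K X Q : C) (k1 k2 : Hom K X)
  (q : Hom X Q) : Prop :=
  q ∘ k1 = q ∘ k2 /\
  forall (W : C) (h : Hom X W), h ∘ k1 = h ∘ k2 -> exists! u : Hom Q W, u ∘ q = h.

Definition RegularEpi (C : Category) (X Q : C) (q : Hom X Q) : Prop :=
  exists (K : C) (k1 k2 : Hom K X), IsCoequaliser k1 k2 q.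

Class Regular (C : Category) : Prop := {
  regular_limits :: HasFiniteLimits C;
  regular_coequalisers : forall (X Y K : C) (f : Hom X Y) (k1 k2 : Hom K X),
    IsKernelPair f k1 k2 -> exists (Q : C) (q : Hom X Q), IsCoequaliser k1 k2 q;
  regular_stable : forall (X Y Z P : C) (f : Hom X Z) (g : Hom Y Z)
    (p1 : Hom P X) (p2 : Hom P Y),
    IsPullback f g p1 p2 -> RegularEpi f -> RegularEpi p2
}.

Definition pair_shape : Category.
Proof.
unshelve refine {| Ob := bool;
  Hom := fun a b => match a, b with
    | true, true | false, false => unit | _, _ => Empty_set end |}.
- intros [|]; exact tt.
- intros [|] [|] [|] g f; solve [exact tt | destruct g | destruct f].
- intros [|] [|] [|] [|] h g f; simpl in *;
    solve [reflexivity | destruct h | destruct g | destruct f].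
- intros [|] [|] f; destruct f; reflexivity.
- intros [|] [|] f; destruct f; reflexivity.
Defined.

Inductive cospan_ob : Set := co_l | co_r | co_m.

Definition cospan_shape : Category.
Proof.
unshelve refine {| Ob := cospan_ob;
  Hom := fun a b => match a, b with
    | co_l, co_l | co_r, co_r | co_m, co_m | co_l, co_m | co_r, co_m => unit
    | _, _ => Empty_set end |}.
- intros [| |]; exact tt.
- intros [| |] [| |] [| |] g f; solve [exact tt | destruct g | destruct f].
- intros [| |] [| |] [| |] [| |] h g f; simpl in *;
    solve [reflexivity | destruct h | destruct g | destruct f].
- intros [| |] [| |] f; destruct f; reflexivity.
- intros [| |] [| |] f; destruct f; reflexivity.
Defined.

Lemma Finite_unit : Finite unit.
Proof. exists (tt :: nil); intros []; left; reflexivity. Qed.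

Lemma Finite_empty : Finite Empty_set.
Proof. exists nil; intros []. Qed.

Lemma pair_shape_finite : FiniteCategory pair_shape.
Proof.
split.
- exists (true :: false :: nil); intros [|]; simpl; auto.
- intros [|] [|]; first [exact Finite_unit | exact Finite_empty].
Qed.

Lemma cospan_shape_finite : FiniteCategory cospan_shape.
Proof.
split.
- exists (co_l :: co_r :: co_m :: nil); intros [| |]; simpl; auto.
- intros [| |] [| |]; first [exact Finite_unit | exact Finite_empty].
Qed.

Definition pair_diagram (C : Category) (X Y : C) : Functor pair_shape C.
Proof.
unshelve refine {| fobj := fun b : pair_shape => if b then X else Y |}.
- intros [|] [|] f; first [exact (idm _) | destruct f].
- intros [|]; reflexivity.
- intros [|] [|] [|] g f; simpl in *;
    solve [symmetry; apply comp_idl | destruct g | destruct f].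
Defined.

Definition cospan_diagram (C : Category) (X Y Z : C) (f : Hom X Z) (g : Hom Y Z) :
  Functor cospan_shape C.
Proof.
unshelve refine {| fobj := fun b : cospan_shape =>
  match b with co_l => X | co_r => Y | co_m => Z end |}.
- intros [| |] [| |] h;
    first [exact (idm _) | exact f | exact g | destruct h].
- intros [| |]; reflexivity.
- intros [| |] [| |] [| |] k h; simpl in *;
    solve [symmetry; apply comp_idl | symmetry; apply comp_idr
          | destruct k | destruct h].
Defined.

Lemma product_exists (C : Category) (HC : HasFiniteLimits C) (X Y : C) :
  exists (P : C) (p1 : Hom P X) (p2 : Hom P Y), IsProduct p1 p2.
Proof.
destruct (finite_limits (pair_diagram X Y) pair_shape_finite) as [L HL].
exists (apex L), (leg L true), (leg L false); intros W f g.
unshelve epose (K := {| apex := W;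
  leg := fun j : pair_shape =>
    if j return Hom W (pair_diagram X Y j) then f else g |} :
  Cone (pair_diagram X Y)).
{ intros [|] [|] h; simpl in *; solve [apply comp_idl | destruct h]. }
destruct (HL K) as [u [Hu Uu]]; exists u; split.
- exact (conj (Hu true) (Hu false)).
- intros v [H1 H2]; apply Uu; intros [|]; assumption.
Qed.

Lemma pullback_exists (C : Category) (HC : HasFiniteLimits C) (X Y Z : C)
  (f : Hom X Z) (g : Hom Y Z) :
  exists (P : C) (p1 : Hom P X) (p2 : Hom P Y), IsPullback f g p1 p2.
Proof.
destruct (finite_limits (cospan_diagram f g) cospan_shape_finite) as [L HL].
pose proof (leg_natural L (i := co_l) (j := co_m) tt) as Ef.
pose proof (leg_natural L (i := co_r) (j := co_m) tt) as Eg.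
exists (apex L), (leg L co_l), (leg L co_r); split.
{ exact (eq_trans Ef (eq_sym Eg)). }
intros W a b Eab.
unshelve epose (K := {| apex := W;
  leg := fun j : cospan_shape =>
    match j return Hom W (cospan_diagram f g j) with
    | co_l => a | co_r => b | co_m => f ∘ a end |} :
  Cone (cospan_diagram f g)).
{ intros [| |] [| |] h; simpl in *;
    solve [apply comp_idl | reflexivity | symmetry; exact Eab | destruct h]. }
destruct (HL K) as [u [Hu Uu]]; exists u; split.
- exact (conj (Hu co_l) (Hu co_r)).
- intros v [H1 H2]; apply Uu; intros [| |]; try assumption.
  simpl in *; rewrite <- Ef, <- comp_assoc, H1; reflexivity.
Qed.

Record Product (C : Category) (X Y : C) : Type := {
  prod_ob :> C;
  pr1 : Hom prod_ob X;
  pr2 : Hom prod_ob Y;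
  prodP : IsProduct pr1 pr2
}.

Record Pullback (C : Category) (X Y Z : C) (f : Hom X Z) (g : Hom Y Z) : Type := {
  pb_ob :> C;
  pb1 : Hom pb_ob X;
  pb2 : Hom pb_ob Y;
  pbP : IsPullback f g pb1 pb2
}.

Definition choose (T : Type) (H : exists _ : T, True) : T :=
  proj1_sig (constructive_indefinite_description _ H).

Definition product (C : Category) `{HasFiniteLimits C} (X Y : C) : Product X Y.
Proof.
apply choose; destruct (product_exists _ X Y) as (P & p1 & p2 & HP).
exists {| prodP := HP |}; exact I.
Defined.

Definition pullback (C : Category) `{HasFiniteLimits C} (X Y Z : C)
  (f : Hom X Z) (g : Hom Y Z) : Pullback f g.
Proof.
apply choose; destruct (pullback_exists _ f g) as (P & p1 & p2 & HP).
exists {| pbP := HP |}; exact I.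
Defined.

Notation "X × Y" := (prod_ob (product X Y)) (at level 40, left associativity) :
  cat_scope.

Definition pairing (C : Category) `{HasFiniteLimits C} (W X Y : C)
  (f : Hom W X) (g : Hom W Y) : Hom W (X × Y) :=
  proj1_sig (constructive_indefinite_description _ (prodP (product X Y) f g)).

Notation "⟨ f , g ⟩" := (pairing f g) : cat_scope.

Lemma pairingP (C : Category) `{HasFiniteLimits C} (W X Y : C)
  (f : Hom W X) (g : Hom W Y) :
  pr1 (product X Y) ∘ ⟨f, g⟩ = f /\ pr2 (product X Y) ∘ ⟨f, g⟩ = g.
Proof.
exact (proj1 (proj2_sig
  (constructive_indefinite_description _ (prodP (product X Y) f g)))).
Qed.

(* A subobject is handled through a representing monomorphism; two representatives
   give the same subobject when each is [≼] the other. *)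
Record Subobject (C : Category) (X : C) : Type := {
  sub_ob :> C;
  sub_mor : Hom sub_ob X;
  sub_mono : Mono sub_mor
}.

Definition factors (C : Category) (W X : C) (f : Hom W X) (S : Subobject X) : Prop :=
  exists u : Hom W S, sub_mor S ∘ u = f.

Definition sub_le (C : Category) (X : C) (R S : Subobject X) : Prop :=
  factors (sub_mor R) S.

Notation "R ≼ S" := (sub_le R S) (at level 70, no associativity) : cat_scope.

Lemma meet_mono (C : Category) (X : C) (R S : Subobject X)
  (P : Pullback (sub_mor R) (sub_mor S)) : Mono (sub_mor R ∘ pb1 P).
Proof.
intros W f g E; destruct (pbP P) as [Hc Hu].
rewrite <- !comp_assoc in E.
assert (E1 : pb1 P ∘ f = pb1 P ∘ g) by exact (sub_mono E).
assert (E2 : pb2 P ∘ f = pb2 P ∘ g).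
{ apply (sub_mono (s := S)); rewrite !comp_assoc, <- Hc, <- !comp_assoc; exact E. }
destruct (Hu W (pb1 P ∘ g) (pb2 P ∘ g)) as [u [_ Uu]].
{ rewrite !comp_assoc, Hc; reflexivity. }
rewrite <- (Uu f), <- (Uu g); auto.
Qed.

Definition meet (C : Category) `{HasFiniteLimits C} (X : C) (R S : Subobject X) :
  Subobject X :=
  {| sub_mor := sub_mor R ∘ pb1 (pullback (sub_mor R) (sub_mor S));
     sub_mono := meet_mono (P := pullback (sub_mor R) (sub_mor S)) |}.

Notation "R ⋏ S" := (meet R S) (at level 39, left associativity) : cat_scope.

Lemma meetP (C : Category) `{HasFiniteLimits C} (X : C) (R S Q : Subobject X) :
  Q ≼ R ⋏ S <-> Q ≼ R /\ Q ≼ S.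
Proof.
unfold sub_le, factors; simpl.
set (P := pullback (sub_mor R) (sub_mor S)); destruct (pbP P) as [Hc Hu]; split.
- intros [u Eu]; split; [exists (pb1 P ∘ u) | exists (pb2 P ∘ u)];
    rewrite comp_assoc; [| rewrite <- Hc]; exact Eu.
- intros [[a Ea] [b Eb]].
  destruct (Hu _ a b) as [u [[E1 _] _]]; [rewrite Ea, Eb; reflexivity |].
  exists u; rewrite <- comp_assoc, E1; exact Ea.
Qed.

Definition Relation (C : Category) `{HasFiniteLimits C} (A : C) : Type :=
  Subobject (A × A).

Section Relations.
Context (C : Category) `{HasFiniteLimits C} (A : C).
Implicit Types R S T : Relation A.

Definition rel1 R : Hom R A := pr1 (product A A) ∘ sub_mor R.
Definition rel2 R : Hom R A := pr2 (product A A) ∘ sub_mor R.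

Definition related R (X : C) (x y : Hom X A) : Prop := factors ⟨x, y⟩ R.

Definition reflexive R : Prop :=
  exists e : Hom A R, rel1 R ∘ e = idm A /\ rel2 R ∘ e = idm A.

Definition symmetric R : Prop :=
  exists s : Hom R R, rel1 R ∘ s = rel2 R /\ rel2 R ∘ s = rel1 R.

Definition transitive R : Prop :=
  let P := pullback (rel2 R) (rel1 R) in
  exists t : Hom P R, rel1 R ∘ t = rel1 R ∘ pb1 P /\ rel2 R ∘ t = rel2 R ∘ pb2 P.

Definition equivalence_relation R : Prop :=
  reflexive R /\ symmetric R /\ transitive R.

End Relations.

Lemma regular_epi_epi (C : Category) (X Q W : C) (q : Hom X Q) (f g : Hom Q W) :
  RegularEpi q -> f ∘ q = g ∘ q -> f = g.
Proof.
intros (K & k1 & k2 & Hc & Hu) E.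
destruct (Hu W (f ∘ q)) as [u [_ Uu]].
{ rewrite <- !comp_assoc, Hc; reflexivity. }
rewrite <- (Uu f), <- (Uu g); auto.
Qed.

Lemma factorisation_exists (C : Category) (HC : Regular C) (X Y : C) (f : Hom X Y) :
  exists (M : Subobject Y) (e : Hom X M), RegularEpi e /\ sub_mor M ∘ e = f.
Proof.
destruct (pullback_exists _ f f) as (K & k1 & k2 & HK).
destruct (regular_coequalisers HK) as (Q & e & He).
assert (Re : RegularEpi e) by (exists K, k1, k2; exact He).
destruct (proj2 He Y f (proj1 HK)) as [m [Em _]].
assert (Hm : Mono m).
{ intros W x y Exy.
  destruct (pullback_exists _ e x) as (P & p & q & HP).
  destruct (pullback_exists _ e (y ∘ q)) as (P' & p' & q' & HP').
  apply (regular_epi_epi (regular_stable HP Re)).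
  apply (regular_epi_epi (regular_stable HP' Re)).
  rewrite <- (proj1 HP), <- (proj1 HP').
  destruct (proj2 HK P' (p ∘ q') p') as [w [[E1 E2] _]].
  { rewrite <- Em, <- !comp_assoc, (proj1 HP'), (comp_assoc e), (proj1 HP).
    rewrite !comp_assoc, Exy; reflexivity. }
  rewrite <- E2, <- (comp_assoc e), <- E1, !comp_assoc, (proj1 He).
  reflexivity. }
exists {| sub_mono := Hm |}, e; split; assumption.
Qed.

Definition image (C : Category) `{Regular C} (X Y : C) (f : Hom X Y) : Subobject Y :=
  proj1_sig (constructive_indefinite_description _ (factorisation_exists _ f)).

Lemma imageP (C : Category) `{Regular C} (X Y : C) (f : Hom X Y) :
  exists e : Hom X (image f), RegularEpi e /\ sub_mor (image f) ∘ e = f.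
Proof.
exact (proj2_sig (constructive_indefinite_description _ (factorisation_exists _ f))).
Qed.

Definition rel_comp (C : Category) `{Regular C} (A : C) (R S : Relation A) :
  Relation A :=
  let P := pullback (rel2 R) (rel1 S) in
  image ⟨rel1 R ∘ pb1 P, rel2 S ∘ pb2 P⟩.

Notation "R ⊙ S" := (rel_comp R S) (at level 40, left associativity) : cat_scope.

(* [alternating k U V] is U ⊙ (V ⊙ (U ⊙ ...)) with [k] factors, for [1 <= k];
   the value at [k = 0] is junk. *)
Fixpoint alternating (k : nat) (C : Category) `{Regular C} (A : C)
  (U V : Relation A) : Relation A :=
  match k with
  | 0 | 1 => U
  | S k' => U ⊙ alternating k' V U
  end.

Definition Jonsson (n : nat) (C : Category) `{Regular C} : Prop :=
  forall (A : C) (R S T : Relation A),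
    equivalence_relation R -> equivalence_relation S -> equivalence_relation T ->
    R ⋏ (S ⊙ T) ≼ alternating (n + 1) (R ⋏ S) (R ⋏ T).
Arguments Jonsson n C {_}.

Definition TrapezoidLemma (C : Category) `{HasFiniteLimits C} : Prop :=
  forall (A : C) (R S T : Relation A),
    equivalence_relation R -> equivalence_relation S -> equivalence_relation T ->
    R ⋏ S ≼ T ->
    forall (X : C) (x y u v : Hom X A),
      related S x u -> related T u v -> related S y v -> related R x y ->
      related T x y.
Arguments TrapezoidLemma C {_}.

(* Main.v *)
(* In elements: let B be T itself, seen as the object of pairs (a, b) with a T b.
   Given x S u T v S y and x R y, put on B the equivalence relations
     R' := R on both coordinates,  S' := S on the first,  T' := S on the second.
   Then (x, x) S' (u, v) T' (y, y) and (x, x) R' (y, y), so the Jónsson condition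
   links (x, x) to (y, y) by a chain of steps in R' ∧ S' and R' ∧ T'.  Each step
   (a, b), (a', b') satisfies a T a': in the first case because R ∧ S ≤ T, in the
   second because a T b T b' T a'.  Hence x T y. *)
Require Import Defs.

Set Implicit Arguments.
Unset Strict Implicit.

Local Open Scope cat_scope.

Section GeneralisedElements.
Context (C : Category) `{HasFiniteLimits C}.

Lemma product_ext (X Y W : C) (f g : Hom W (X × Y)) :
  pr1 (product X Y) ∘ f = pr1 (product X Y) ∘ g ->
  pr2 (product X Y) ∘ f = pr2 (product X Y) ∘ g -> f = g.
Proof.
intros E1 E2.
destruct (prodP (product X Y) (pr1 (product X Y) ∘ g) (pr2 (product X Y) ∘ g))
  as [u [_ Uu]].
rewrite <- (Uu f), <- (Uu g); auto.
Qed.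

Lemma relatedP (A : C) (R : Relation A) (X : C) (x y : Hom X A) :
  related R x y <-> exists w : Hom X R, rel1 R ∘ w = x /\ rel2 R ∘ w = y.
Proof.
destruct (pairingP x y) as [E1 E2]; unfold related, factors, rel1, rel2; split.
- intros [w Ew]; exists w; rewrite <- !comp_assoc, Ew; auto.
- intros [w [W1 W2]]; exists w.
  apply product_ext; rewrite comp_assoc; congruence.
Qed.

Lemma related_comp (A : C) (R : Relation A) (X Y : C) (x y : Hom X A) (f : Hom Y X) :
  related R x y -> related R (x ∘ f) (y ∘ f).
Proof.
rewrite !relatedP; intros [w [<- <-]]; exists (w ∘ f).
rewrite !comp_assoc; auto.
Qed.

Lemma related_self (A : C) (R : Relation A) : related R (rel1 R) (rel2 R).
Proof. apply relatedP; exists (idm R); rewrite !comp_idr; auto. Qed.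

(** For the converse direction, test on the generic related pair [(rel1 R, rel2 R)]: its lift to [S]
    is the inclusion. Relations can thus be compared on generalised elements, as in sets. *)
Lemma sub_leP (A : C) (R S : Relation A) :
  R ≼ S <-> forall (X : C) (x y : Hom X A), related R x y -> related S x y.
Proof.
split.
- intros [i Ei] X x y [w Ew]; exists (i ∘ w).
  rewrite comp_assoc, Ei; exact Ew.
- intros HRS; destruct (proj1 (relatedP _ _ _) (HRS _ _ _ (related_self R)))
    as [i [E1 E2]].
  exists i; apply product_ext; rewrite comp_assoc; assumption.
Qed.

(** [meetP] tests only against subobjects, whereas [⟨x, y⟩] need not be mono; the pullback property
    handles arbitrary pairs. *)
Lemma related_meet (A : C) (R S : Relation A) (X : C) (x y : Hom X A) :
  related (R ⋏ S) x y <-> related R x y /\ related S x y.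
Proof.
unfold related, factors; simpl.
set (P := pullback (sub_mor R) (sub_mor S)); destruct (pbP P) as [Hc Hu]; split.
- intros [w Ew]; split; [exists (pb1 P ∘ w) | exists (pb2 P ∘ w)];
    rewrite comp_assoc; [| rewrite <- Hc]; exact Ew.
- intros [[a Ea] [b Eb]].
  destruct (Hu _ a b) as [w [[E1 _] _]]; [congruence |].
  exists w; rewrite <- comp_assoc, E1; exact Ea.
Qed.

(** From right to left, each structure morphism comes from a generic instance: the identity of [A],
    the projections of [R], and the pullback [P] of composable pairs. *)
Lemma equivalence_relationP (A : C) (R : Relation A) :
  equivalence_relation R <->
  (forall (X : C) (x : Hom X A), related R x x) /\
  (forall (X : C) (x y : Hom X A), related R x y -> related R y x) /\
  (forall (X : C) (x y z : Hom X A),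
     related R x y -> related R y z -> related R x z).
Proof.
set (P := pullback (rel2 R) (rel1 R)); destruct (pbP P) as [Hc Hu]; split.
- intros [[e [E1 E2]] [[s [S1 S2]] [t [T1 T2]]]]; fold P in t, T1, T2.
  split; [| split].
  + intros X x; apply relatedP; exists (e ∘ x).
    rewrite !comp_assoc, E1, E2, comp_idl; auto.
  + intros X x y; rewrite !relatedP; intros [w [<- <-]]; exists (s ∘ w).
    rewrite !comp_assoc, S1, S2; auto.
  + intros X x y z; rewrite !relatedP; intros [w [W1 W2]] [w' [W1' W2']].
    destruct (Hu X w w') as [p [[P1 P2] _]]; [congruence |].
    exists (t ∘ p).
    rewrite !comp_assoc, T1, T2, <- !comp_assoc, P1, P2; auto.
- intros [Hr [Hs Ht]]; split; [| split].
  + apply relatedP, Hr.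
  + apply relatedP, Hs, related_self.
  + unfold transitive; fold P; apply relatedP, (Ht _ _ (rel2 R ∘ pb1 P)).
    * apply related_comp, related_self.
    * rewrite Hc; apply related_comp, related_self.
Qed.

Lemma meet_equivalence (A : C) (R S : Relation A) :
  equivalence_relation R -> equivalence_relation S -> equivalence_relation (R ⋏ S).
Proof.
rewrite !equivalence_relationP; intros [Rr [Rs Rt]] [Sr [Ss St]].
split; [| split]; intros *; rewrite !related_meet; [auto | intuition auto |].
intros [] []; eauto.
Qed.

Lemma pullback_mono (X Y Z : C) (f : Hom X Z) (g : Hom Y Z) (P : Pullback f g) :
  Mono f -> Mono (pb2 P).
Proof.
intros Hf W a b E; destruct (pbP P) as [Hc Hu].
assert (E1 : pb1 P ∘ a = pb1 P ∘ b).
{ apply Hf; rewrite !comp_assoc, Hc, <- !comp_assoc, E; reflexivity. }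
destruct (Hu W (pb1 P ∘ b) (pb2 P ∘ b)) as [w [_ Uw]].
{ rewrite !comp_assoc, Hc; reflexivity. }
rewrite <- (Uw a), <- (Uw b); auto.
Qed.

(** The pairing is [f × f], so this is the inverse image of [R] along [f × f]. *)
Definition preimage (A B : C) (f : Hom B A) (R : Relation A) : Relation B :=
  {| sub_mor := pb2 (pullback (sub_mor R)
       ⟨f ∘ pr1 (product B B), f ∘ pr2 (product B B)⟩);
     sub_mono := pullback_mono (P := pullback _ _) (@sub_mono _ _ R) |}.

Lemma related_preimage (A B : C) (f : Hom B A) (R : Relation A) (X : C)
  (x y : Hom X B) : related (preimage f R) x y <-> related R (f ∘ x) (f ∘ y).
Proof.
assert (E : ⟨f ∘ pr1 (product B B), f ∘ pr2 (product B B)⟩ ∘ ⟨x, y⟩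
            = ⟨f ∘ x, f ∘ y⟩).
{ destruct (pairingP (f ∘ pr1 (product B B)) (f ∘ pr2 (product B B))) as [P1 P2].
  destruct (pairingP x y) as [Q1 Q2], (pairingP (f ∘ x) (f ∘ y)) as [R1 R2].
  apply product_ext; rewrite comp_assoc.
  - rewrite P1, R1, <- comp_assoc, Q1; reflexivity.
  - rewrite P2, R2, <- comp_assoc, Q2; reflexivity. }
unfold related, factors; simpl; rewrite <- E.
set (P := pullback _ _); destruct (pbP P) as [Hc Hu]; split.
- intros [w Ew]; exists (pb1 P ∘ w).
  rewrite comp_assoc, Hc, <- comp_assoc, Ew; reflexivity.
- intros [w Ew]; destruct (Hu X w ⟨x, y⟩ Ew) as [p [[_ Ep] _]].
  exists p; exact Ep.
Qed.

Lemma preimage_equivalence (A B : C) (f : Hom B A) (R : Relation A) :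
  equivalence_relation R -> equivalence_relation (preimage f R).
Proof.
rewrite !equivalence_relationP; intros [Rr [Rs Rt]].
split; [| split]; intros *; rewrite !related_preimage; eauto.
Qed.

End GeneralisedElements.

Section Composition.
Context (C : Category) `{Regular C}.

(** The regular epi [e] coequalises some pair [k1], [k2]. Since [S] is mono, the lift [u] of [f]
    also equalises that pair, so it descends along [e]. *)
Lemma image_le (X Y : C) (f : Hom X Y) (S : Subobject Y) :
  factors f S -> image f ≼ S.
Proof.
intros [u Eu]; destruct (imageP f) as [e [He Ee]].
pose proof He as (K & k1 & k2 & Hk & Hq).
destruct (Hq _ u) as [h [Eh _]].
{ apply (sub_mono (s := S)).
  rewrite !comp_assoc, Eu, <- Ee, <- !comp_assoc, Hk; reflexivity. }
exists h; apply (regular_epi_epi He); rewrite <- comp_assoc, Eh; congruence.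
Qed.

Lemma rel_comp_intro (A : C) (R S : Relation A) (X : C) (x y z : Hom X A) :
  related R x y -> related S y z -> related (rel_comp R S) x z.
Proof.
rewrite (relatedP R), (relatedP S); intros [r [R1 R2]] [s [S1 S2]].
set (P := pullback (rel2 R) (rel1 S)).
destruct (proj2 (pbP P) X r s) as [p [[P1 P2] _]]; [congruence |].
destruct (imageP ⟨rel1 R ∘ pb1 P, rel2 S ∘ pb2 P⟩) as [e [_ Ee]].
destruct (pairingP (rel1 R ∘ pb1 P) (rel2 S ∘ pb2 P)) as [Q1 Q2].
destruct (pairingP x z) as [Z1 Z2].
exists (e ∘ p); rewrite comp_assoc.
transitivity (⟨rel1 R ∘ pb1 P, rel2 S ∘ pb2 P⟩ ∘ p);
  [exact (f_equal (fun h => h ∘ p) Ee) |].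
apply product_ext; rewrite comp_assoc.
- rewrite Q1, Z1, <- comp_assoc, P1; exact R1.
- rewrite Q2, Z2, <- comp_assoc, P2; exact S2.
Qed.

(** Minimality of the image reduces the claim to the span out of [P], where the middle element is
    available and transitivity of [W] applies; no element of the composite has to be decomposed. *)
Lemma rel_comp_le (A : C) (R S W : Relation A) :
  equivalence_relation W -> R ≼ W -> S ≼ W -> rel_comp R S ≼ W.
Proof.
rewrite equivalence_relationP, !sub_leP; intros [_ [_ Wt]] HR HS.
apply sub_leP, image_le.
set (P := pullback (rel2 R) (rel1 S)).
apply (Wt _ _ (rel2 R ∘ pb1 P)).
- apply HR, related_comp, related_self.
- rewrite (proj1 (pbP P)); apply HS, related_comp, related_self.
Qed.

Lemma alternating_le (k : nat) (A : C) (U V W : Relation A) :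
  equivalence_relation W -> U ≼ W -> V ≼ W -> alternating k U V ≼ W.
Proof.
(* The recursive call swaps [U] and [V], so both are generalised; lengths 0 and 1 both give [U]. *)
intros HW; revert U V; induction k as [| [| k] IH]; intros U V HU HV.
- exact HU.
- exact HU.
- apply rel_comp_le; [exact HW | exact HU | apply IH; assumption].
Qed.

End Composition.

Theorem proposition3p13 (n : nat) (hn : 1 <= n) (C : Category) (HC : Regular C)
  (HJ : Jonsson n C) : TrapezoidLemma C.
Proof.
intros A R S T ER ES ET HRS X x y u v Hxu Huv Hyv Hxy.
pose proof (proj1 (equivalence_relationP T) ET) as [Tr [Ts Tt]].
pose proof (proj1 (equivalence_relationP S) ES) as [_ [Ss _]].
rewrite sub_leP in HRS.
(* The pairs (x, x), (u, v), (y, y) become morphisms from [X] to the object [T]. *)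
destruct (proj1 (relatedP T x x) (Tr X x)) as [xx [X1 X2]].
destruct (proj1 (relatedP T u v) Huv) as [uv [U1 V2]].
destruct (proj1 (relatedP T y y) (Tr X y)) as [yy [Y1 Y2]].
set (R' := preimage (rel1 T) R ⋏ preimage (rel2 T) R).
set (S' := preimage (rel1 T) S); set (T' := preimage (rel2 T) S).
(* [W] compares first coordinates by [T]. Being an equivalence relation, it absorbs alternating
   chains of any length once it contains both kinds of step. *)
set (W := preimage (rel1 T) T).
assert (EW : equivalence_relation W) by (apply preimage_equivalence; exact ET).
assert (H1 : R' ⋏ S' ≼ W).
{ apply sub_leP; unfold R', S', W; intros Z a b.
  rewrite !related_meet, !related_preimage; intros [[Ra _] Sa].
  apply HRS, related_meet; auto. }
assert (H2 : R' ⋏ T' ≼ W).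
{ apply sub_leP; unfold R', T', W; intros Z a b.
  rewrite !related_meet, !related_preimage; intros [[_ Rb] Sb].
  pose proof (related_self T) as HT.
  (* Detour through second coordinates: a and b are themselves [T]-related pairs, and their second
     coordinates are [T]-related by [HRS]. *)
  apply (Tt _ _ (rel2 T ∘ a)); [apply related_comp, HT |].
  apply (Tt _ _ (rel2 T ∘ b)); [| apply Ts, related_comp, HT].
  apply HRS, related_meet; auto. }
assert (HW : related W xx yy).
{ apply (proj1 (sub_leP _ _) (alternating_le (n + 1) EW H1 H2)).
  apply (proj1 (sub_leP _ _) (HJ _ R' S' T'
    (meet_equivalence (preimage_equivalence _ ER) (preimage_equivalence _ ER))
    (preimage_equivalence _ ES) (preimage_equivalence _ ES))).
  (* The [R'] part reduces to x R y, twice. For the composite, [uv] is the middle element: x S u on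
     first coordinates, v S y on second ones. *)
  unfold R'; rewrite !related_meet, !related_preimage, X1, X2, Y1, Y2.
  split; [auto |].
  apply (rel_comp_intro (y := uv)); apply related_preimage.
  - rewrite X1, U1; exact Hxu.
  - rewrite V2, Y2; apply Ss, Hyv. }
unfold W in HW; rewrite related_preimage, X1, Y1 in HW; exact HW.
Qed.
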